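(* Let $D$ be a division ring finite-dimensional over its center $K$. Suppose that $D$ is endowed with a valuation extending a nontrivial valuation on $K$, and let $M_D=\{a\in D: v(a)>0\}$. Then the group $1+M_D$ is nonabelian if and only if $D$ is noncommutative.
   Context: A valuation on a division ring $D$ is a function $v:D\to\Gamma\cup\{\infty\}$, where $\Gamma$ is a totally ordered additive abelian group and $\infty$ is larger than every element of $\Gamma$ and absorbing for addition, such that for all $x,y\in D$: $v(x)=\infty$ iff $x=0$; $v(x+y)\ge\min\{v(x),v(y)\}$; $v(xy)=v(x)+v(y)$. It is nontrivial on $K$ if $v(a)\neq 0$ for some $a\in K^*=K\setminus\{0\}$. The set $1+M_D$ is a normal subgroup of the multiplicative group $D^*=D\setminus\{0\}$. *)

(* Defs.v *)
From HB Require Import structures.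
From mathcomp Require Import all_boot all_order all_algebra all_field.

Set Implicit Arguments.
Unset Strict Implicit.
Unset Printing Implicit Defensive.

Import Order.TTheory GRing.Theory Num.Theory.
Local Open Scope ring_scope.

(* [porderZmodType] joins a partial order and an abelian group law without any
   compatibility between them. *)
Record totally_ordered_group (G : porderZmodType) : Prop := TotallyOrderedGroup {
  tog_le_total : total (<=%R : rel G);
  tog_lerD2l : forall z x y : G, x <= y -> z + x <= z + y
}.

(* [Gamma \cup {oo}], with [None] standing for [oo]. *)
Definition with_infty (G : Type) : Type := option G.

Definition infty {G : Type} : with_infty G := None.

Section WithInfty.
Variable G : porderZmodType.

HB.instance Definition _ := Choice.on (with_infty G).

Implicit Types u v w : with_infty G.

Definition le_infty u v : bool :=
  match u, v with
  | _, None => true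
  | None, Some _ => false
  | Some a, Some b => a <= b
  end.

Definition add_infty u v : with_infty G :=
  match u, v with
  | Some a, Some b => Some (a + b)
  | _, _ => None
  end.

Fact le_infty_refl : reflexive le_infty.
Proof. by case=> [a|] /=. Qed.

Fact le_infty_anti : antisymmetric le_infty.
Proof. by case=> [a|] [b|] //= ab; congr Some; apply/le_anti. Qed.

Fact le_infty_trans : transitive le_infty.
Proof. by case=> [a|] [b|] [c|] //=; apply: le_trans. Qed.

HB.instance Definition _ := Order.Le_isPOrder.Build ring_display (with_infty G)
  le_infty_refl le_infty_anti le_infty_trans.

Fact add_inftyA : associative add_infty.
Proof. by case=> [a|] [b|] [c|] //=; rewrite addrA. Qed.

Fact add_inftyC : commutative add_infty.
Proof. by case=> [a|] [b|] //=; rewrite addrC. Qed.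

Fact add_infty0 : left_id (Some 0 : with_infty G) add_infty.
Proof. by case=> [a|] //=; rewrite add0r. Qed.

HB.instance Definition _ := GRing.isNmodule.Build (with_infty G)
  add_inftyA add_inftyC add_infty0.

End WithInfty.

Definition division_ring (R : unitRingType) : Prop :=
  forall x : R, x != 0 -> x \is a GRing.unit.

Record is_valuation (R : nzRingType) (G : porderZmodType)
    (v : R -> with_infty G) : Prop := IsValuation {
  valuation_infty : forall x, v x = infty <-> x = 0;
  valuation_add : forall x y, Num.min (v x) (v y) <= v (x + y);
  valuation_mul : forall x y, v (x * y) = v x + v y
}.

Definition nontrivial_valuation (R : nzRingType) (G : porderZmodType)
    (v : R -> with_infty G) : Prop :=
  exists2 a : R, a != 0 & v a != 0.

Section OnePlus.
Variables (R : unitRingType) (G : porderZmodType) (v : R -> with_infty G).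

Definition val_ideal : {pred R} := [pred a | (0 : with_infty G) < v a].

Definition one_plus_ideal : {pred R} := [pred x | x - 1 \in val_ideal].

Lemma one_plus_idealP x :
  reflect (exists2 a, a \in val_ideal & x = 1 + a) (x \in one_plus_ideal).
Proof.
apply: (iffP idP) => [xM | [a aM ->]]; first by exists (x - 1); rewrite // addrC subrK.
by rewrite inE addrAC subrr add0r.
Qed.

(* [one_plus_ideal] is a normal subgroup of the group of nonzero elements. *)
Section Subgroup.
Hypotheses (G_ordered : totally_ordered_group G) (R_division : division_ring R).
Hypothesis v_valuation : is_valuation v.

Local Notation fin a := (Some a : with_infty G).

Fact fin_leE (a b : G) : (fin a <= fin b) = (a <= b). Proof. by []. Qed.

Fact fin_addE (a b : G) : fin a + fin b = fin (a + b). Proof. by []. Qed.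

Fact val_fin x : x != 0 -> exists a, v x = fin a.
Proof.
case E: (v x) => [a|] x0; first by exists a.
by case/eqP: x0; apply/(valuation_infty v_valuation).
Qed.

Fact val1 : v 1 = 0.
Proof.
have [a va] := val_fin (oner_neq0 R).
have := valuation_mul v_valuation 1 1.
by rewrite mulr1 va fin_addE => -[/eqP]; rewrite -subr_eq subrr => /eqP <-.
Qed.

Fact val_sign : v (-1) = 0.
Proof.
have [|a va] := @val_fin (-1); first by rewrite oppr_eq0 oner_neq0.
have := valuation_mul v_valuation (-1) (-1).
rewrite mulrNN mulr1 va val1 fin_addE => -[/eqP]; rewrite eq_sym => /eqP aa.
congr Some; apply/le_anti/andP.
have [a0|a0] := orP (tog_le_total G_ordered a 0).
  by split=> //; have := tog_lerD2l G_ordered a a0; rewrite aa addr0.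
by split=> //; have := tog_lerD2l G_ordered a a0; rewrite aa addr0.
Qed.

Fact valN x : v (- x) = v x.
Proof. by rewrite -mulN1r (valuation_mul v_valuation) val_sign add0r. Qed.

Fact infty_le_total : total (<=%R : rel (with_infty G)).
Proof. by case=> [a|] [b|] //=; apply: (tog_le_total G_ordered). Qed.

Fact infty_ltNge (u w : with_infty G) : (u < w) = ~~ (w <= u).
Proof. 
rewrite lt_leAnge; have := infty_le_total u w.
by case: (w <= u); case: (u <= w).
Qed.

Fact infty_leD2l (u t w : with_infty G) : t <= w -> u + t <= u + w.
Proof. by case: u t w => [a|] [b|] [c|] //=; apply: (tog_lerD2l G_ordered). Qed.

Fact val_ideal_add a b : a \in val_ideal -> b \in val_ideal -> a + b \in val_ideal.
Proof.
rewrite !inE => a0 b0; apply: lt_le_trans (valuation_add v_valuation a b).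
by rewrite minEle; case: ifP.
Qed.

Fact val_ideal_mull a b : a \in val_ideal -> (0 : with_infty G) <= v b -> a * b \in val_ideal.
Proof.
rewrite !inE => a0 b0; rewrite (valuation_mul v_valuation).
by apply: lt_le_trans a0 _; rewrite -{1}[v a]addr0; apply: infty_leD2l.
Qed.

Fact val_one_plus x : x \in one_plus_ideal -> v x = 0.
Proof.
rewrite 2!inE => x0; apply/le_anti/andP; split.
  rewrite -[v x <= (0 : with_infty G)]negbK -infty_ltNge; apply/negP => vx.
  suff: (0 : with_infty G) < v 1 by rewrite val1 ltxx.
  have -> : 1 = x - (x - 1) by rewrite opprB addrC subrK.
  by apply: val_ideal_add; rewrite inE ?valN.
have := valuation_add v_valuation (x - 1) 1; rewrite subrK val1.
by apply: le_trans; rewrite minEle; case: ifP => // _; apply: ltW.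
Qed.

Lemma one_plus_ideal1 : 1 \in one_plus_ideal.
Proof.
by rewrite 2!inE subrr; have /(valuation_infty v_valuation) -> : 0 = 0 :> R by [].
Qed.

Lemma one_plus_idealM x y :
  x \in one_plus_ideal -> y \in one_plus_ideal -> x * y \in one_plus_ideal.
Proof.
move=> x1 y1; rewrite inE.
have -> : x * y - 1 = (x - 1) * y + (y - 1).
  by rewrite mulrBl mul1r addrA subrK.
by apply: val_ideal_add => //; apply: val_ideal_mull; rewrite ?(val_one_plus y1).
Qed.

Lemma one_plus_ideal_unit x : x \in one_plus_ideal -> x \is a GRing.unit.
Proof.
move=> /val_one_plus vx; apply: R_division; apply/eqP.
by move=> /(valuation_infty v_valuation); rewrite vx.
Qed.

Lemma one_plus_idealV x : x \in one_plus_ideal -> x^-1 \in one_plus_ideal.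
Proof.
move=> x1; have xU := one_plus_ideal_unit x1.
have vV : v x^-1 = 0.
  by rewrite -val1 -(divrr xU) (valuation_mul v_valuation) (val_one_plus x1) add0r.
have -> : x^-1 = 1 + - ((x - 1) * x^-1).
  by rewrite mulrBl divrr // mul1r opprB addrC subrK.
apply/one_plus_idealP; exists (- ((x - 1) * x^-1)) => //.
by rewrite inE valN; apply: val_ideal_mull; rewrite ?vV.
Qed.

Lemma one_plus_idealJ x y :
  y != 0 -> x \in one_plus_ideal -> y^-1 * x * y \in one_plus_ideal.
Proof.
move=> /R_division yU x1; rewrite 2!inE.
have -> : y^-1 * x * y - 1 = y^-1 * (x - 1) * y.
  by rewrite mulrBr mulrBl mulr1 mulVr.
rewrite !(valuation_mul v_valuation) addrAC -(valuation_mul v_valuation) mulVr //.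
by rewrite val1 add0r.
Qed.

End Subgroup.

End OnePlus.

(* Main.v *)
(* Every [x] in [D] can be scaled into [M_D] by a nonzero [t] in [K]: if
   [v x < 0], then finite dimensionality puts [x] in [K[x^-1]], say
   [x = \sum_i k_i x^-i]; as [v (x^-i) >= 0], some coefficient satisfies
   [w k_i <= v x], and [t = t0 / k_i] works for any [t0] with [w t0 > 0].
   When [1 + M_D] is abelian, [1 + t x] and [1 + s y] commute for suitable
   nonzero central [t] and [s], hence so do [x] and [y]. *)
Require Import Defs.
From HB Require Import structures.
From mathcomp Require Import all_boot all_order all_algebra all_field.
Import Order.TTheory GRing.Theory Num.Theory.
Local Open Scope ring_scope.

Section DivisionRingValuation.

Set Implicit Arguments.
Unset Strict Implicit.

Variables (R : unitRingType) (G : porderZmodType) (v : R -> with_infty G).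
Hypotheses (G_ordered : totally_ordered_group G) (R_division : division_ring R).
Hypothesis v_valuation : is_valuation v.

Local Notation zero := (0 : with_infty G).

(** Finiteness of [c] serves the empty sum, whose value is [infty]. *)
Lemma val_sum_gt (I : finType) (F : I -> R) (c : with_infty G) :
  c < infty -> (forall i, c < v (F i)) -> c < v (\sum_i F i).
Proof.
move=> c_fin cF; apply: (big_ind (fun x => c < v x)) => // [|x y cx cy].
  by rewrite (iffRL (valuation_infty v_valuation _)).
apply: lt_le_trans (valuation_add v_valuation x y).
by rewrite minEle; case: ifP.
Qed.

Lemma valX_ge0 x n : zero <= v x -> zero <= v (x ^+ n).
Proof.
move=> x0; elim: n => [|n IHn]; first by rewrite expr0 (Defs.val1 v_valuation).
rewrite exprS (valuation_mul v_valuation); apply: le_trans x0 _.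
by rewrite -[leLHS]addr0; apply: infty_leD2l.
Qed.

Lemma val_mulVr x : x != 0 -> v x^-1 + v x = zero.
Proof.
move=> x0; rewrite -(valuation_mul v_valuation) mulVr ?R_division //.
exact: (Defs.val1 v_valuation).
Qed.

(** Otherwise, adding [v x] to [v x^-1 <= 0] would give [0 <= v x]. *)
Lemma valV_gt0 x : x != 0 -> v x < zero -> zero < v x^-1.
Proof.
move=> x0; rewrite !infty_ltNge //; apply: contra => xV0.
have := infty_leD2l G_ordered (v x) xV0.
by rewrite addr0 addrC val_mulVr.
Qed.

(** If [v a] is nonzero, one of [a] and [a^-1] has positive value. *)
Lemma nontrivial_val_gt0 :
  nontrivial_valuation v -> exists2 a, a != 0 & zero < v a.
Proof.
case=> a a0 va0; case: (boolP (zero < v a)) => [|]; first by exists a.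
rewrite infty_ltNge // negbK => va; exists a^-1; first by rewrite invr_neq0.
by apply: valV_gt0; rewrite // lt_neqAle va0.
Qed.

End DivisionRingValuation.

(** The subalgebra [agenv <[x]>] is finite-dimensional, hence closed under inverses, and it is the
    sum of the lines spanned by the powers of [x] below the dimension of [D]. For a non-unit, [x^-1]
    is [x] by convention and lies there too. *)
Lemma inv_sum_powers (K : fieldType) (D : falgType K) (x : D) :
  exists n (k : 'I_n -> K), x^-1 = \sum_i k i *: x ^+ i.
Proof.
have: x^-1 \in agenv <[x]>%VS.
  by rewrite memvV (subvP (sub_agenv _)) ?memv_line.
case/memv_sumP=> u u_pow ->; exists (\dim {:D})%VS.
have k_ex (i : 'I_(\dim {:D})) : exists k, u i == k *: x ^+ i.
  by have := u_pow i isT; rewrite expv_line => /vlineP[k ->]; exists k.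
exists (fun i => xchoose (k_ex i)); apply: eq_bigr => i _.
exact/eqP/(xchooseP (k_ex i)).
Qed.

Section ScaleIntoIdeal.

Set Implicit Arguments.
Unset Strict Implicit.

Variables (K : fieldType) (D : falgType K) (G : porderZmodType).
Variables (w : K -> with_infty G) (v : D -> with_infty G).
Hypotheses (G_ordered : totally_ordered_group G) (D_division : division_ring D).
Hypotheses (w_valuation : is_valuation w) (v_valuation : is_valuation v).
Hypothesis w_nontrivial : nontrivial_valuation w.
Hypothesis v_extends_w : forall a : K, v a%:A = w a.

(** Lets the facts on valued division rings be applied to [w] as well as to [v]. *)
Lemma field_division_ring : division_ring K.
Proof. by move=> a; rewrite unitfE. Qed.

Lemma valZ k x : v (k *: x) = w k + v x.
Proof. by rewrite -mulr_algl (valuation_mul v_valuation) v_extends_w. Qed.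

Lemma scale_lower_bound x : exists2 k, k != 0 & w k <= v x.
Proof.
have [vx0|] := boolP ((0 : with_infty G) <= v x).
  by exists 1; rewrite ?oner_neq0 // (Defs.val1 w_valuation).
rewrite -infty_ltNge // => vx.
have vx_fin : v x < infty by apply: lt_le_trans vx _.
have x0 : x != 0.
  by apply/eqP => /(valuation_infty v_valuation) vxE; rewrite vxE ltxx in vx_fin.
have vV i : (0 : with_infty G) <= v (x^-1 ^+ i).
  by apply: (valX_ge0 G_ordered v_valuation); apply/ltW/valV_gt0.
have [n [k]] := inv_sum_powers x^-1; rewrite invrK => xE.
have [/existsP[i ki]|] := boolP [exists i, w (k i) <= v x].
  (* A zero coefficient would have value [infty], but [w (k i) <= v x] is finite. *)
  exists (k i) => //; apply/eqP => /(valuation_infty w_valuation) wk.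
  by move: (le_lt_trans ki vx_fin); rewrite wk ltxx.
rewrite negb_exists => /forallP k_gt.
(* If all coefficients had value above [v x], so would all terms, and then their sum [x]. *)
suff: v x < v x by rewrite ltxx.
rewrite {2}xE; apply: val_sum_gt => // i; rewrite valZ.
rewrite (@lt_le_trans _ _ (w (k i))) ?infty_ltNge //.
by rewrite -[leLHS]addr0; apply: infty_leD2l.
Qed.

Lemma scale_into_ideal x : exists2 t, t != 0 & t *: x \in val_ideal v.
Proof.
have [k k0 kx] := scale_lower_bound x.
have [t0 t0_neq0 wt0] :=
  nontrivial_val_gt0 G_ordered field_division_ring w_valuation w_nontrivial.
exists (t0 * k^-1); first by rewrite mulf_neq0 ?invr_neq0.
(* Since [w k <= v x], [w t0 + (w k^-1 + v x)] is at least [w t0 + (w k^-1 + w k) = w t0]. *)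
rewrite inE valZ (valuation_mul w_valuation) -addrA.
apply: lt_le_trans wt0 _; rewrite -[leLHS]addr0.
apply: infty_leD2l => //; rewrite -(val_mulVr field_division_ring w_valuation k0).
exact: infty_leD2l.
Qed.

(** Removing the central summand [1] preserves commutation; the nonzero scalar [t * s] then cancels
    from both products. *)
Lemma comm_one_plus_scale (t s : K) (x y : D) : t != 0 -> s != 0 ->
  GRing.comm (1 + t *: x) (1 + s *: y) -> GRing.comm x y.
Proof.
move=> t0 s0 txy.
have {}txy : GRing.comm (t *: x) (s *: y).
  rewrite -[t *: x](addKr 1) -[s *: y](addKr 1).
  by do 2!(apply/commr_sym/commrD; first exact/commrN/commr1).
move: txy; rewrite /GRing.comm -!scalerAl -!scalerAr !scalerA (mulrC s).
exact/scalerI/mulf_neq0.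
Qed.

End ScaleIntoIdeal.

Theorem theorem2p3 (K : fieldType) (D : falgType K) (G : porderZmodType)
    (w : K -> with_infty G) (v : D -> with_infty G)
    (G_ordered : totally_ordered_group G)
    (D_division : division_ring D)
    (D_center : 'Z({:D})%VS = 1%VS)
    (w_valuation : is_valuation w)
    (w_nontrivial : nontrivial_valuation w)
    (v_valuation : is_valuation v)
    (v_extends_w : forall a : K, v a%:A = w a) :
  ~ {in one_plus_ideal v &, commutative (@GRing.mul D)} <->
  ~ commutative (@GRing.mul D).
Proof.
(* Both directions are proved by contraposition; commutativity passes to the subset at once. *)
split=> nC C; apply: nC => x y; first by move=> _ _; exact: C.
have scale := scale_into_ideal G_ordered D_division w_valuation v_valuation
  w_nontrivial v_extends_w.
have [[t t0 tx] [s s0 sy]] := (scale x, scale y).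
apply: (comm_one_plus_scale t0 s0).
by apply: C; apply/one_plus_idealP; [exists (t *: x) | exists (s *: y)].
Qed.
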